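(* For locally compact paracompact spaces $X$ and $Y$ the following conditions are equivalent. (1) $\mathcal T^*_S(X)$ and $\mathcal T^*_S(Y)$ are order-isomorphic; (2) $\sigma X\setminus X$ and $\sigma Y\setminus Y$ are homeomorphic.
   Context: Compact, locally compact and paracompact spaces are assumed Hausdorff. For a Tychonoff space $X$, a one-point extension of $X$ is a Tychonoff space $T$ containing $X$ as a dense subspace such that $T\setminus X$ is a singleton; we write $T=X\cup\{p\}$. Two extensions are identified if there is a homeomorphism between them fixing $X$ pointwise. For extensions $T_1,T_2$ of $X$, $T_2\leq T_1$ means there is a continuous $f:T_1\to T_2$ fixing $X$ pointwise; this is a partial order on the set $\mathcal T(X)$ of all (equivalence classes of) one-point extensions of $X$. $\mathcal T^*_S(X)$ is the set (with the induced order) of all $T=X\cup\{p\}\in\mathcal T(X)$ such that $T$ is first countable at $p$ and $U\setminus\{p\}$ is $\sigma$-compact for some neighborhood $U$ of $p$ in $T$ (a neighborhood of $p$ is a set containing an open set containing $p$). $\beta X$ is the Stone-Čech compactification of $X$ and $\sigma X=\bigcup\{\mathrm{cl}_{\beta X}A: A\subseteq X\text{ is }\sigma\text{-compact}\}$. Partially ordered sets are order-isomorphic if there is a bijection between them that is order-preserving with order-preserving inverse. *)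

(* Defs.v *)
From HB Require Import structures.
From mathcomp Require Export all_boot all_order all_algebra.
From mathcomp Require Export all_classical all_reals.
From mathcomp Require Export topology normedtype.

Set Implicit Arguments.
Unset Strict Implicit.
Unset Printing Implicit Defensive.

Import Order.TTheory GRing.Theory Num.Theory.
Import numFieldNormedType.Exports.
Local Open Scope classical_set_scope.
Local Open Scope ring_scope.

Definition tychonoff_space (T : topologicalType) : Prop :=
  hausdorff_space T /\ completely_regular_space T.

Definition locally_finite (T : topologicalType) (F : set (set T)) : Prop :=
  forall x : T, exists2 U, nbhs x U & finite_set (F `&` [set A | A `&` U !=set0]).

Definition paracompact_space (T : topologicalType) : Prop :=
  hausdorff_space T /\
  forall C : set (set T), C `<=` open -> \bigcup_(A in C) A = [set: T] ->
  exists D : set (set T),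
    [/\ D `<=` open, \bigcup_(B in D) B = [set: T],
        (forall B, D B -> exists2 A, C A & B `<=` A) & locally_finite D].

Definition locally_compact_space (T : topologicalType) : Prop :=
  hausdorff_space T /\ locally_compact [set: T].

Definition sigma_compact (T : topologicalType) (A : set T) : Prop :=
  exists2 K : nat -> set T, (forall n, compact (K n)) & A = \bigcup_n K n.

Definition first_countable_at (T : topologicalType) (p : T) : Prop :=
  exists2 B : nat -> set T, (forall n, nbhs p (B n)) &
    forall U, nbhs p U -> exists n, B n `<=` U.

Definition homeomorphic (S T : topologicalType) : Prop :=
  exists (f : S -> T) (g : T -> S),
    [/\ continuous f, continuous g, cancel f g & cancel g f].

(* The second clause says that [S] carries the topology induced by [e]. *)
Definition embedding (S T : topologicalType) (e : S -> T) : Prop :=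
  injective e /\
  forall U : set S, open U <-> exists2 V : set T, open V & e @^-1` V = U.

Section stone_cech.
Context (R : realType) (X : topologicalType).

Definition unit_functions : set (X -> R) :=
  [set f : X -> R | continuous f /\ forall x, 0 <= f x <= 1].

Definition unit_product : topologicalType := prod_topology (fun _ : unit_functions => R).

Definition cube_eval (x : X) : unit_product := fun f => set_val f x.

(* The Stone-Cech compactification: the closure of the image of [X] in
   $[0,1]^{C(X,[0,1])}$. That cube is closed in the product of copies of [R], so the
   closure can be taken in the latter. *)
Definition beta : topologicalType := set_type (closure (range cube_eval)).

Lemma cube_eval_closure (x : X) : cube_eval x \in closure (range cube_eval).
Proof. by apply/mem_set/subset_closure; exists x. Qed.

Definition beta_in (x : X) : beta := exist _ (cube_eval x) (cube_eval_closure x).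

Definition sigma_ext : set beta :=
  \bigcup_(A in [set A : set X | sigma_compact A]) closure (beta_in @` A).

Definition sigma_remainder : set beta := sigma_ext `\` range beta_in.

End stone_cech.

Arguments unit_functions R X : clear implicits.
Arguments sigma_ext R X : clear implicits.
Arguments sigma_remainder R X : clear implicits.

Section extensions.
Context (X : topologicalType).

(* [X] is a subspace of the extension through [ext_in]. *)
Record one_point_extension := OnePointExtension {
  ext_space :> topologicalType;
  ext_in : X -> ext_space;
  ext_pt : ext_space;
  ext_tychonoff : tychonoff_space ext_space;
  ext_embedding : embedding ext_in;
  ext_dense : dense (range ext_in);
  ext_remainder : ~` range ext_in = [set ext_pt]
}.

Definition ext_equiv (T1 T2 : one_point_extension) : Prop :=
  exists (f : T1 -> T2) (g : T2 -> T1),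
    [/\ continuous f, continuous g, cancel f g, cancel g f &
        forall x, f (ext_in T1 x) = ext_in T2 x].

(* [ext_le T2 T1] is $T_2 \leq T_1$. *)
Definition ext_le (T2 T1 : one_point_extension) : Prop :=
  exists2 f : T1 -> T2, continuous f & forall x, f (ext_in T1 x) = ext_in T2 x.

(* Not [set one_point_extension]: that lives in too large a universe for [set]. *)
Definition ext_class : Type :=
  {C : one_point_extension -> Prop | exists T, C = ext_equiv T}.

Definition ext_class_le (C2 C1 : ext_class) : Prop :=
  exists T2 T1, [/\ sval C2 T2, sval C1 T1 & ext_le T2 T1].

Definition in_TstarS (C : ext_class) : Prop :=
  exists T : one_point_extension,
    [/\ sval C T, first_countable_at (ext_pt T) &
        exists2 U, nbhs (ext_pt T) U & sigma_compact (U `\ ext_pt T)].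

Definition TstarS : Type := {C : ext_class | in_TstarS C}.

Definition TstarS_le (C2 C1 : TstarS) : Prop :=
  ext_class_le (sval C2) (sval C1).

End extensions.

Arguments TstarS_le X : clear implicits.

Definition order_isomorphic (A B : Type) (leA : A -> A -> Prop)
    (leB : B -> B -> Prop) : Prop :=
  exists (f : A -> B) (g : B -> A), [/\ cancel f g, cancel g f,
    (forall x y, leA x y -> leB (f x) (f y)) &
    (forall x y, leB x y -> leA (g x) (g y))].

(* Main.v *)
Require Import Defs.
From mathcomp Require Import all_boot all_order all_algebra.
From mathcomp Require Import all_classical all_reals topology.
From mathcomp Require Import normedtype borel_hierarchy.

Set Implicit Arguments.
Unset Strict Implicit.
Unset Printing Implicit Defensive.

Import Order.TTheory GRing.Theory Num.Theory.
Import numFieldNormedType.Exports.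
Local Open Scope classical_set_scope.
Local Open Scope ring_scope.

(** Let K be the Stone-Cech compactification of X and S the remainder
    of X in sigma X.  A one-point extension T = X + p leaves a trace in K, its
    fiber: the set of points of K at which the traces on X of the
    neighbourhoods of p cluster (this is the preimage of p under the map
    from K to the compactification of T).  The fiber is a nonempty compact
    subset of K missing X, and because every continuous function from X to
    [0, 1] extends to K, it determines T: a set containing p is a
    neighbourhood of p iff its trace on X contains the trace of an open subset
    of K around the fiber (nbhs_ext_ptP).  Hence one-point extensions,
    ordered by domination, are the nonempty compact subsets of K missing X,
    ordered by reverse inclusion (ext_leP); every such set C is a fiber since
    collapsing C to a point in X + C gives an extension (fiber_collapse).

    Under this dictionary first countability at p says that the fiber is a
    G-delta of K, and a neighbourhood U of p with U minus p sigma-compact says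
    that the fiber lies in sigma X.  Here paracompactness enters: a
    sigma-compact subset of a locally compact paracompact space is contained
    in a clopen sigma-compact set B (sigma_compact_clopen_hull), and the
    closure of B in K is then clopen and meets S in a compact open subset whose
    complement in that closure is the sigma-compact set B.  It follows that
    S is locally compact, that a compact subset of S is a G-delta of S iff it
    is a G-delta of K, and that the ordered set of the theorem is the set of
    nonempty compact G-deltas of the space S under reverse inclusion
    (TstarS_compact_Gdelta_order).

    This ordered set is a topological invariant of S, which gives one
    implication.  For the other, a locally compact Hausdorff space is recovered
    from its compact G-deltas (compact_Gdelta_order_homeomorphic): an order
    isomorphism matches the filters of the compact G-deltas through a given
    point, because nonemptiness of intersections is visible in the order. *)

(** * Separation, compactness and G-deltas *)

Lemma nbhs_openP (T : topologicalType) (x : T) (A : set T) :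
  nbhs x A <-> exists U, [/\ open U, U x & U `<=` A].
Proof.
rewrite nbhsE; split=> [[U [oU Ux] UA]|[U [oU Ux UA]]]; exists U => //.
Qed.

Lemma hausdorff_nbhs (T : topologicalType) (x y : T) :
  hausdorff_space T -> x <> y ->
  exists U V, [/\ open U, open V, U x, V y & U `&` V = set0].
Proof.
rewrite open_hausdorff => hT /eqP /hT [[U V]] /=.
rewrite !inE => -[Ux Vy] [oU oV UV]; by exists U, V.
Qed.

Lemma hausdorff_injective (S T : topologicalType) (f : S -> T) :
  continuous f -> injective f -> hausdorff_space T -> hausdorff_space S.
Proof.
move=> cf injf hT x y cxy; apply: injf; apply: hT => A B fA fB.
have [z [Az Bz]] := cxy _ _ (cf x A fA) (cf y B fB).
by exists (f z).
Qed.

(** Compactness can be tested in an ambient space; this serves both for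
    [set_type] and for the domain of an embedding. *)
Lemma compact_initial (S T : topologicalType) (f : S -> T) (A : set S) :
  (forall U, open U -> exists2 V, open V & f @^-1` V = U) ->
  compact (f @` A) -> compact A.
Proof.
move=> fo cA F PF FA.
have [|_ [[x Ax <-] cx]] := cA (f @ F) _ _.
  apply: (@filterS _ F _ A) FA => z Az; by exists z.
exists x; split=> // B C FB /nbhs_openP [U [oU Ux UC]].
have [V oV UE] := fo _ oU.
have [||_ [[z Bz <-] Vz]] := cx (f @` B) V.
- by apply: (@filterS _ F _ B) FB => z Bz; exists z.
- by apply: open_nbhs_nbhs; split=> //; rewrite -UE in Ux.
by exists z; split=> //; apply: UC; rewrite -UE.
Qed.

Lemma set_val_continuous (T : topologicalType) (A : set T) :
  continuous (set_val : A -> T).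
Proof. exact: initial_continuous. Qed.

Lemma dense_open_closure (T : topologicalType) (D O : set T) :
  dense D -> open O -> O `<=` closure (O `&` D).
Proof.
move=> dD oO y Oy N /nbhs_openP [V [oV Vy VN]].
have [|z [[Oz Vz] Dz]] := dD (O `&` V) _ (openI oO oV); first by exists y.
by exists z; split; [split|apply: VN].
Qed.

Lemma closure_min (T : topologicalType) (A B : set T) :
  closed B -> A `<=` B -> closure A `<=` B.
Proof. by move=> clB AB; rewrite ((closure_id B).1 clB); exact: closureS. Qed.

Lemma closure_disjoint (T : topologicalType) (A O : set T) (x : T) :
  closure A x -> open O -> O x -> A `&` O !=set0.
Proof. by move=> clA oO Ox; apply: clA; exact: open_nbhs_nbhs. Qed.

(** The filter form of the fact that, in a compact space, a filtering family of
    closed sets whose intersection lies in an open set [O] has a member in [O]: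
    otherwise the filter could be restricted to the complement of [O], where it
    would have a cluster point. *)
Lemma compact_cluster_sub (T : topologicalType) (F : set_system T) (O : set T) :
  compact [set: T] -> Filter F -> open O -> cluster F `<=` O -> F O.
Proof.
move=> cT FF oO clFO; apply: contrapT => nFO.
have PG : ProperFilter (within (~` O) F).
  apply: Build_ProperFilter => // FO0; apply: nFO.
  by move: FO0; rewrite /within /=; apply: filterS => x h; apply: contrapT => /h.
have [y [_ cly]] := cT (within (~` O) F) PG filterT.
have : closure (~` O) y.
  move=> N Ny; apply: cly Ny; exact: (@filterE _ F).
rewrite -(closure_id _).1; last exact: open_closedC.
apply; apply: clFO => A B FA; apply: cly; exact: filterS FA.
Qed.

Lemma compact_urysohn (R : realType) (T : topologicalType) (A B : set T) :
  hausdorff_space T -> compact [set: T] -> closed A -> closed B ->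
  A `&` B = set0 ->
  exists f : T -> R, [/\ continuous f, forall x, 0 <= f x <= 1,
    forall x, A x -> f x = 0 & forall x, B x -> f x = 1].
Proof.
move=> hT cT clA clB AB.
have /(@uniform_separatorP _ R) [f [cf f01 fA fB]] :=
  (@normal_separatorP R T).1 (compact_normal hT cT) _ _ clA clB AB.
exists f; split=> // [x|x Ax|x Bx].
- by have := f01 (f x) (ex_intro2 _ _ x I erefl); rewrite /= in_itv.
- by apply: fA; exists x.
- by apply: fB; exists x.
Qed.

Lemma completely_regular_urysohn (R : realType) (T : topologicalType)
    (x : T) (O : set T) :
  completely_regular_space T -> open O -> O x ->
  exists f : T -> R, [/\ continuous f, forall y, 0 <= f y <= 1,
    f x = 0 & forall y, ~ O y -> f y = 1].
Proof.
move=> crT oO Ox.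
have /(@uniform_separatorP _ R) [f [cf f01 fA fB]] :=
  crT x (~` O) (open_closedC oO) (fun nO => nO Ox).
exists f; split=> // [y||y Oy].
- by have := f01 (f y) (ex_intro2 _ _ y I erefl); rewrite /= in_itv.
- by apply: fA; exists x.
- by apply: fB; exists y.
Qed.

Section level_sets.
Context (R : realType) (T : topologicalType) (f : T -> R) (cf : continuous f).

Lemma open_flt (a : R) : open [set x | f x < a].
Proof. by apply: (@open_comp _ _ f [set y | y < a]) => // ; exact: open_lt. Qed.

Lemma open_fgt (a : R) : open [set x | a < f x].
Proof. by apply: (@open_comp _ _ f [set y | a < y]) => // ; exact: open_gt. Qed.

Lemma closed_fle (a : R) : closed [set x | f x <= a].
Proof. by apply: (@preimage_closed _ _ f [set y | y <= a]) => // ; exact: closed_le. Qed.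

Lemma closed_feq (a : R) : closed [set x | f x = a].
Proof. by apply: (@preimage_closed _ _ f [set y | y = a]) => // ; exact: closed_eq. Qed.

Lemma Gdelta_fle (a : R) : Gdelta [set x | f x <= a].
Proof.
exists (fun n => [set x | f x < a + n.+1%:R^-1]); first by move=> n; exact: open_flt.
apply/seteqP; split=> x /= fx.
  by move=> n _ /=; rewrite (le_lt_trans fx)// ltrDl invr_gt0 ltr0n.
apply/ler_addgt0Pr => e e0.
have [n ne] : exists n, n.+1%:R^-1 < e.
  exists (Num.truncn e^-1); rewrite invf_plt ?posrE ?ltr0n//.
  exact: truncnS_gt.
by apply/ltW/(lt_trans (fx n I)); rewrite ltrD2l.
Qed.

End level_sets.

Lemma continuous_prod (S : topologicalType) (I : eqType) (K : I -> topologicalType)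
    (f : S -> prod_topology K) :
  (forall i, continuous (fun x => f x i)) -> continuous f.
Proof.
move=> cf x; apply/cvg_sup => i U [V [[W oW <-] Wf] WU].
by apply: (filterS WU); apply: (cf i x); exact: open_nbhs_nbhs.
Qed.

Lemma Gdelta_preimage (S T : topologicalType) (f : S -> T) (A : set T) :
  continuous f -> Gdelta A -> Gdelta (f @^-1` A).
Proof.
move=> cf [O oO ->]; exists (fun n => f @^-1` (O n)).
  by move=> n; apply: open_comp.
by rewrite preimage_bigcap.
Qed.

Lemma GdeltaI (T : topologicalType) (A B : set T) :
  Gdelta A -> Gdelta B -> Gdelta (A `&` B).
Proof.
move=> [O oO ->] [P oP ->].
exists (fun n => O n `&` P n); first by move=> n; exact: openI.
by rewrite bigcapI.
Qed.

Section embeddings.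
Context (S T : topologicalType) (e : S -> T) (emb : embedding e).

Lemma embedding_continuous : continuous e.
Proof. by apply/continuousP => V oV; apply/emb.2; exists V. Qed.

Lemma embedding_open (U : set S) :
  open U -> exists2 V, open V & e @^-1` V = U.
Proof. by move/(emb.2 U).1. Qed.

Lemma embedding_open_map (U : set S) :
  open (range e) -> open U -> open (e @` U).
Proof.
move=> oe /embedding_open [V oV <-].
rewrite (_ : _ @` _ = V `&` range e); first exact: openI.
apply/seteqP; split=> [_ [x Vx <-]|t [Vt [x _ xE]]]; first by split=> //; exists x.
by exists x => //=; rewrite xE.
Qed.

End embeddings.

Lemma open_bigcapn (T : topologicalType) (U : nat -> set T) (n : nat) :
  (forall i, open (U i)) -> open (\bigcap_(i < n) U i).
Proof.
by move=> oU; rewrite bigcap_mkord; elim/big_ind: _ => //; [exact: openT|exact: openI].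
Qed.

(** Shrink each open set of the G-delta presentation to a neighbourhood of [C] whose
    closure it contains; the finite intersections of the shrunken sets cluster
    only at points of [C]. *)
Lemma closed_Gdelta_nbhs_base (T : topologicalType) (C : set T) :
  hausdorff_space T -> compact [set: T] -> closed C -> Gdelta C ->
  exists2 W : nat -> set T, (forall n, open (W n) /\ C `<=` W n) &
    forall O, open O -> C `<=` O -> exists n, W n `<=` O.
Proof.
move=> hT cT clC [P oP CE].
have CP n : C `<=` P n by rewrite CE; apply: bigcap_inf.
have /choice [U UP] : forall n, exists U, [/\ open U, C `<=` U & closure U `<=` P n].
  move=> n; have /(compact_normal hT cT clC) [A nA AP] : set_nbhs C (P n).
    by apply/set_nbhsP; exists (P n); split=> //; exact: oP.
  move/set_nbhsP : nA => [U [oU CU UA]]; exists U; split=> //.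
  exact: subset_trans (closureS UA) AP.
have oU n : open (U n) by have [] := UP n.
exists (fun n => \bigcap_(i < n.+1) U i).
  move=> n; split; first exact: open_bigcapn.
  by move=> y Cy i _; have [_ /(_ _ Cy)] := UP i.
pose F := filter_from [set: nat] (fun n => \bigcap_(i < n.+1) U i).
have FF : Filter F.
  apply: filter_from_filter; first by exists 0%N.
  move=> m n _ _; exists (maxn m n) => // y Uy; split=> i /= im; apply: Uy => /=.
    by rewrite (leq_trans im)// ltnS leq_maxl.
  by rewrite (leq_trans im)// ltnS leq_maxr.
move=> O oO CO; have [|n _ nO] := @compact_cluster_sub _ F O cT FF oO _; last by exists n.
apply: subset_trans CO => y; rewrite clusterE CE => cly n _.
have [_ _] := UP n; apply; apply: cly; exists n => // z; apply => /=.
exact: ltnSn.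
Qed.

(** * Order isomorphisms *)

Lemma sval_inj (A : Type) (P : A -> Prop) : injective (@sval A P).
Proof. by move=> x y; apply: eq_sig_hprop => z p q; exact: Prop_irrelevance. Qed.

Lemma order_isomorphic_sym (A B : Type) (leA : A -> A -> Prop) (leB : B -> B -> Prop) :
  order_isomorphic leA leB -> order_isomorphic leB leA.
Proof. by move=> [f [g [? ? ? ?]]]; exists g, f. Qed.

Lemma order_isomorphic_trans (A B C : Type) (leA : A -> A -> Prop)
    (leB : B -> B -> Prop) (leC : C -> C -> Prop) :
  order_isomorphic leA leB -> order_isomorphic leB leC -> order_isomorphic leA leC.
Proof.
move=> [f [g [fg gf fm gm]]] [f' [g' [fg' gf' fm' gm']]].
exists (f' \o f), (g \o g'); split; try exact: can_comp.
- by move=> x y xy; apply/fm'/fm.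
- by move=> x y xy; apply/gm/gm'.
Qed.

Lemma order_isomorphic_embed (A B : Type) (leA : A -> A -> Prop)
    (leB : B -> B -> Prop) (f : A -> B) :
  injective f -> (forall y, exists x, f x = y) ->
  (forall x y, leA x y <-> leB (f x) (f y)) -> order_isomorphic leA leB.
Proof.
move=> injf /choice [g gK] fle; exists f, g; split=> //.
- by move=> x; apply: injf; rewrite gK.
- by move=> x y /fle.
- by move=> x y xy; apply/fle; rewrite !gK.
Qed.

(** * Recovering a locally compact space from its compact G-deltas *)

Definition is_compact_Gdelta (S : topologicalType) : set (set S) :=
  [set Z | [/\ Z !=set0, compact Z & Gdelta Z]].

Definition compact_Gdelta (S : topologicalType) : Type :=
  {Z : set S | is_compact_Gdelta Z}.

Definition compact_Gdelta_ge (S : topologicalType) (Z1 Z2 : compact_Gdelta S) : Prop :=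
  sval Z2 `<=` sval Z1.

(** For Tychonoff spaces this is local compactness; it is the form in
    which that hypothesis is used. *)
Definition has_compact_Gdelta_base (S : topologicalType) : Prop :=
  forall (x : S) (V : set S), open V -> V x ->
  exists Z : compact_Gdelta S, nbhs x (sval Z) /\ sval Z `<=` V.

Lemma compact_Gdelta_compact (S : topologicalType) (Z : compact_Gdelta S) :
  compact (sval Z).
Proof. by case: (svalP Z). Qed.

Lemma compact_Gdelta_closed (S : topologicalType) (Z : compact_Gdelta S) :
  hausdorff_space S -> closed (sval Z).
Proof. by move=> hS; apply: compact_closed => //; exact: compact_Gdelta_compact. Qed.

Lemma compact_Gdelta_sub2 (S : topologicalType) (Z1 Z2 : compact_Gdelta S) (x : S) :
  hausdorff_space S -> sval Z1 x -> sval Z2 x ->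
  exists Z : compact_Gdelta S, [/\ sval Z x, sval Z `<=` sval Z1 & sval Z `<=` sval Z2].
Proof.
move=> hS Z1x Z2x.
have cZ : is_compact_Gdelta (sval Z1 `&` sval Z2).
  split; first by exists x.
    by apply: compact_closedI; [exact: compact_Gdelta_compact|exact: compact_Gdelta_closed].
  by case: (svalP Z1) (svalP Z2) => _ _ ? [_ _]; exact: GdeltaI.
by exists (exist _ _ cZ); split; [split|exact: subIsetl|exact: subIsetr].
Qed.

Section related_points.
Context (S S' : topologicalType).
Context (hS : hausdorff_space S) (hS' : hausdorff_space S').
Context (base_S : has_compact_Gdelta_base S) (base_S' : has_compact_Gdelta_base S').
Context (Phi : compact_Gdelta S -> compact_Gdelta S').
Context (Psi : compact_Gdelta S' -> compact_Gdelta S).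
Context (PhiK : cancel Phi Psi) (PsiK : cancel Psi Phi).
Context (Phi_mono : forall Z1 Z2,
  compact_Gdelta_ge Z1 Z2 -> compact_Gdelta_ge (Phi Z1) (Phi Z2)).
Context (Psi_mono : forall Z1 Z2,
  compact_Gdelta_ge Z1 Z2 -> compact_Gdelta_ge (Psi Z1) (Psi Z2)).

(** The two points that a homeomorphism inducing [Phi] would match. *)
Definition related (x : S) (y : S') : Prop :=
  forall Z, sval Z x -> sval (Phi Z) y.

(** The images of the compact G-deltas through [x] form a filter base of compact
    sets: two members through [x] contain a third one. *)
Lemma related_exists x : exists y, related x y.
Proof.
pose F := filter_from [set Z : compact_Gdelta S | sval Z x] (fun Z => sval (Phi Z)).
have [Z0 [/nbhs_singleton Z0x _]] := base_S openT (I : [set: S] x).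
have PF : ProperFilter F.
  apply: filter_from_proper; last by move=> Z _; case: (svalP (Phi Z)).
  apply: filter_from_filter; first by exists Z0.
  move=> Z1 Z2 Z1x Z2x; have [Z [Zx Z1s Z2s]] := compact_Gdelta_sub2 hS Z1x Z2x.
  by exists Z => // y Zy; split; apply: Phi_mono Zy.
have [|y [_ cly]] := @compact_Gdelta_compact _ (Phi Z0) F PF; first by exists Z0.
exists y => Z Zx; rewrite ((closure_id _).1 (@compact_Gdelta_closed _ (Phi Z) hS')).
by move: cly; rewrite clusterE; apply; exists Z.
Qed.

(** Maximality of the filter of the compact G-deltas through a point.  If
    [Psi W] missed [x], some [Z] through [x] would be disjoint from [Psi W];
    but [Phi Z] and [W] both contain [y], hence share a compact G-delta, and its
    image under [Psi] is nonempty and lies in both [Z] and [Psi W]. *)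
Lemma related_sub x y (W : compact_Gdelta S') : related x y -> sval W y -> sval (Psi W) x.
Proof.
move=> xy Wy; apply: contrapT => nWx.
have [Z [/nbhs_singleton Zx ZW]] :=
  base_S (closed_openC (compact_Gdelta_closed (Z := Psi W) hS)) nWx.
have [Z' [Z'y Z'Z Z'W]] := compact_Gdelta_sub2 hS' (xy Z Zx) Wy.
have [[z Z'z] _ _] := svalP (Psi Z').
apply: (ZW z); last exact: (@Psi_mono W Z' Z'W).
by rewrite -(PhiK Z); exact: (@Psi_mono (Phi Z) Z' Z'Z).
Qed.

Lemma related_iff x y (Z : compact_Gdelta S) :
  related x y -> (sval Z x <-> sval (Phi Z) y).
Proof. by move=> xy; split=> [/xy//|/(related_sub xy)]; rewrite PhiK. Qed.

Lemma related_unique x y y' : related x y -> related x y' -> y = y'.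
Proof.
move=> xy xy'; apply: contrapT => /eqP yy'.
have oy' : open (~` [set y']).
  by apply: closed_openC; apply: accessible_closed_set1; exact: hausdorff_accessible.
have [W [/nbhs_singleton Wy Wy']] := base_S' oy' (elimN eqP yy').
by apply: (Wy' y') => //; rewrite -(PsiK W); apply: xy'; exact: related_sub Wy.
Qed.

(** With [N] a compact G-delta neighbourhood of [x], each point of the compact set
    [Phi N] off [U] has a neighbourhood [W] in the family that misses [f x], and
    [f] takes no value in [W] off the closed set [Psi W].  Finitely many such
    [W] suffice, which is what the near-covering form of compactness
    expresses. *)
Lemma related_continuous (f : S -> S') : (forall x, related x (f x)) -> continuous f.
Proof.
move=> rf x V /nbhs_openP [U [oU Ux UV]].
have [N [nN _]] := base_S openT (I : [set: S] x).
have /compact_near_coveringP cN := @compact_Gdelta_compact _ (Phi N).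
have near_N : \forall u \near x, sval (Phi N) `<=` [set y | U y \/ f u <> y].
  apply: (cN _ (nbhs x) (fun u y => U y \/ f u <> y)) => y _.
  have [->|yfx] := pselect (y = f x).
    exists (U, setT) => /=; first by split; [exact: open_nbhs_nbhs|exact: filterT].
    by move=> [u v] [/= Uu _]; left.
  have ofx : open (~` [set f x]).
    by apply: closed_openC; apply: accessible_closed_set1; exact: hausdorff_accessible.
  have [W [nW Wx]] := base_S' ofx yfx.
  exists (sval W, ~` sval (Psi W)) => /=.
    split=> //; apply: open_nbhs_nbhs; split.
      by apply: closed_openC; exact: compact_Gdelta_closed.
    by rewrite /= (related_iff _ (rf x)) PsiK => /Wx; exact.
  move=> [y' u] [/= Wy' nWu]; right=> fuy; apply: nWu.
  by rewrite (related_iff _ (rf u)) PsiK fuy.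
apply: (filterS _ (filterI nN near_N)) => u [Nu /(_ (f u))].
by rewrite -(related_iff _ (rf u)) => /(_ Nu) [/UV|].
Qed.

End related_points.

Lemma compact_Gdelta_order_homeomorphic (S S' : topologicalType) :
  hausdorff_space S -> hausdorff_space S' ->
  has_compact_Gdelta_base S -> has_compact_Gdelta_base S' ->
  order_isomorphic (@compact_Gdelta_ge S) (@compact_Gdelta_ge S') -> homeomorphic S S'.
Proof.
move=> hS hS' bS bS' [Phi [Psi [PhiK PsiK Phi_mono Psi_mono]]].
have [f rf] := choice (related_exists hS hS' bS Phi_mono).
have [g rg] := choice (related_exists hS' hS bS' Psi_mono).
exists f, g; split.
- exact: related_continuous rf.
- exact: related_continuous rg.
- move=> x; apply: (related_unique hS' hS bS' bS PsiK PhiK Phi_mono (rg (f x))).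
  by move=> W; apply: (related_sub hS hS' bS PhiK Psi_mono (rf x)).
- move=> y; apply: (related_unique hS hS' bS bS' PhiK PsiK Psi_mono (rf (g y))).
  by move=> W; apply: (related_sub hS' hS bS' PsiK Phi_mono (rg y)).
Qed.

Lemma homeomorphic_compact_Gdelta_order (S S' : topologicalType) :
  homeomorphic S S' -> order_isomorphic (@compact_Gdelta_ge S) (@compact_Gdelta_ge S').
Proof.
have pull (A B : topologicalType) (f : A -> B) (g : B -> A) :
    continuous f -> continuous g -> cancel f g -> cancel g f ->
    forall Z : set A, is_compact_Gdelta Z -> is_compact_Gdelta (g @^-1` Z).
  move=> cf cg fK gK Z [[x Zx] cZ GZ]; split; first by exists (f x); rewrite /= fK.
    rewrite (_ : g @^-1` Z = f @` Z).
      by apply: continuous_compact => //; exact: continuous_subspaceT.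
    apply/seteqP; split=> [y Zy|_ [z Zz <-]]; last by rewrite /= fK.
    by exists (g y).
  exact: Gdelta_preimage.
move=> [f [g [cf cg fK gK]]].
exists (fun Z => exist _ _ (pull _ _ _ _ cf cg fK gK _ (svalP Z))).
exists (fun Z => exist _ _ (pull _ _ _ _ cg cf gK fK _ (svalP Z))).
split.
- by move=> Z; apply: sval_inj; apply/seteqP; split=> x /=; rewrite fK.
- by move=> Z; apply: sval_inj; apply/seteqP; split=> x /=; rewrite gK.
- by move=> Z1 Z2 Z12 x; exact: Z12.
- by move=> Z1 Z2 Z12 x; exact: Z12.
Qed.

(** * One-point extensions *)

Section extension_points.
Context (X : topologicalType) (T : one_point_extension X).

Local Notation e := (@ext_in X T).
Local Notation p := (@ext_pt X T).

Lemma ext_hausdorff : hausdorff_space T.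
Proof. by case: (ext_tychonoff T). Qed.

Lemma ext_in_continuous : continuous e.
Proof. exact: embedding_continuous (ext_embedding T). Qed.

Lemma ext_in_neq_pt x : e x <> p.
Proof.
move=> ep; have : (~` range e) p by rewrite ext_remainder.
by apply; exists x.
Qed.

Lemma ext_case (t : T) : t = p \/ exists x, t = e x.
Proof.
have [[x _ <-]|nt] := pselect (range e t); first by right; exists x.
by left; have : (~` range e) t by []; rewrite ext_remainder.
Qed.

Lemma open_range_ext_in : open (range e).
Proof.
rewrite -[range e]setCK ext_remainder; apply: closed_openC.
by apply: accessible_closed_set1; apply: hausdorff_accessible; exact: ext_hausdorff.
Qed.

Lemma ext_sub (U V : set T) : V p -> e @^-1` U `<=` e @^-1` V -> U `<=` V.
Proof. by move=> Vp UV t Ut; case: (ext_case t) Ut => [->//|[x ->] /UV]. Qed.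

End extension_points.

(** If the added point were sent to a point [x] of [X], separate it from [x] in
    [T1] by [U] and [V]: near the added point [f] takes values in the trace of
    [V], yet [f] is the identity on the dense set [X], so [U] and [V] would
    meet. *)
Lemma ext_le_pt (X : topologicalType) (T1 T2 : one_point_extension X) (f : T1 -> T2) :
  continuous f -> (forall x, f (ext_in T1 x) = ext_in T2 x) ->
  f (ext_pt T1) = ext_pt T2.
Proof.
move=> cf fe; case: (ext_case (f (ext_pt T1))) => // -[x fpx]; exfalso.
have [U [V [oU oV Up Vx UV]]] := hausdorff_nbhs (@ext_hausdorff _ T1)
  (not_eq_sym (@ext_in_neq_pt _ T1 x)).
have oeV : open (ext_in T1 @^-1` V).
  by apply: open_comp => // ? _; exact: ext_in_continuous.
have [W oW WE] := embedding_open (ext_embedding T2) oeV.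
have Wx : W (ext_in T2 x) by rewrite -[W _]/((ext_in T2 @^-1` W) x) WE.
have oUW : open (U `&` f @^-1` W) by apply: openI => //; apply: open_comp.
have [|t [[Uz Wz] [z _ zE]]] := @ext_dense _ T1 _ _ oUW.
  by exists (ext_pt T1); split=> //=; rewrite fpx.
move: Uz Wz; rewrite -zE /= fe -[W _]/((ext_in T2 @^-1` W) z) WE => Uz Vz.
by have : (U `&` V) (ext_in T1 z) by []; rewrite UV.
Qed.

Lemma ext_le_anti (X : topologicalType) (T1 T2 : one_point_extension X) :
  ext_le T1 T2 -> ext_le T2 T1 -> ext_equiv T1 T2.
Proof.
move=> [g cg ge] [f cf fe]; exists f, g; split=> //.
- move=> t; case: (ext_case t) => [->|[x ->]]; last by rewrite fe ge.
  by rewrite (ext_le_pt cf fe) (ext_le_pt cg ge).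
- move=> t; case: (ext_case t) => [->|[x ->]]; last by rewrite ge fe.
  by rewrite (ext_le_pt cg ge) (ext_le_pt cf fe).
Qed.

Lemma ext_equiv_le (X : topologicalType) (T1 T2 : one_point_extension X) :
  ext_equiv T1 T2 -> ext_le T2 T1 /\ ext_le T1 T2.
Proof.
move=> [f [g [cf cg fg gf fe]]]; split; first by exists f.
by exists g => // x; rewrite -fe fg.
Qed.

Lemma ext_le_trans (X : topologicalType) (T1 T2 T3 : one_point_extension X) :
  ext_le T1 T2 -> ext_le T2 T3 -> ext_le T1 T3.
Proof.
move=> [f cf fe] [g cg ge]; exists (f \o g); last by move=> x; rewrite /= ge fe.
by move=> x; apply: continuous_comp; [exact: cg|exact: cf].
Qed.

Lemma ext_equiv_refl (X : topologicalType) (T : one_point_extension X) : ext_equiv T T.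
Proof. by exists id, id; split=> // x; exact: cvg_id. Qed.

Lemma ext_equiv_sym (X : topologicalType) (T1 T2 : one_point_extension X) :
  ext_equiv T1 T2 -> ext_equiv T2 T1.
Proof.
by move=> [f [g [cf cg fg gf fe]]]; exists g, f; split=> // x; rewrite -fe fg.
Qed.

Lemma ext_equiv_trans (X : topologicalType) (T1 T2 T3 : one_point_extension X) :
  ext_equiv T1 T2 -> ext_equiv T2 T3 -> ext_equiv T1 T3.
Proof.
move=> [f [g [cf cg fg gf fe]]] [f' [g' [cf' cg' fg' gf' fe']]].
exists (f' \o f), (g \o g'); split.
- by move=> x; apply: continuous_comp; [exact: cf|exact: cf'].
- by move=> x; apply: continuous_comp; [exact: cg'|exact: cg].
- exact: can_comp.
- exact: can_comp.
- by move=> x /=; rewrite fe fe'.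
Qed.

(** * Fibers of one-point extensions *)

Section fibers.
Context (R : realType) (X K : topologicalType) (b : X -> K).
Context (cK : compact [set: K]) (emb_b : embedding b).
Context (ext_b : forall f : X -> R, continuous f -> (forall x, 0 <= f x <= 1) ->
  exists2 g : K -> R, continuous g & g \o b = f).

Definition trace_filter (T : one_point_extension X) : set_system K :=
  filter_from (nbhs (ext_pt T)) (fun U => b @` (ext_in T @^-1` U)).

(** The preimage of the added point under the continuous map from [K] to the
    Stone-Cech compactification of [T] that fixes [X]. *)
Definition fiber (T : one_point_extension X) : set K := cluster (trace_filter T).

#[local] Instance trace_filter_proper T : ProperFilter (trace_filter T).
Proof.
apply: filter_from_proper.
  apply: filter_from_filter; first by exists setT; exact: filterT.
  move=> U V nU nV; exists (U `&` V); first exact: filterI.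
  by move=> _ [x [Ux Vx] <-]; split; exists x.
move=> U /nbhs_openP [V [oV Vp VU]].
have [|t [Vx [x _ xE]]] := @ext_dense _ T _ _ oV; first by exists (ext_pt T).
by exists (b x), x => //; apply: VU; rewrite xE.
Qed.

Lemma fiber_closed (T : one_point_extension X) : closed (fiber T).
Proof. by rewrite /fiber clusterE; apply: closed_bigI => A _; exact: closed_closure. Qed.

Lemma fiber_neq0 (T : one_point_extension X) : fiber T !=set0.
Proof. by have [y [_ cy]] := cK (trace_filter_proper T) filterT; exists y. Qed.

Lemma fiber_sub_closure (T : one_point_extension X) (U : set T) :
  nbhs (ext_pt T) U -> fiber T `<=` closure (b @` (ext_in T @^-1` U)).
Proof. by move=> nU y; rewrite /fiber clusterE; apply; exists U. Qed.

Lemma fiber_notin (T : one_point_extension X) x : ~ fiber T (b x).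
Proof.
have [U [V [oU oV Up Vx UV]]] := hausdorff_nbhs (@ext_hausdorff _ T)
  (not_eq_sym (@ext_in_neq_pt _ T x)).
have oeV : open (ext_in T @^-1` V).
  by apply: open_comp => // ? _; exact: ext_in_continuous.
have [W oW WE] := embedding_open emb_b oeV.
move=> /(fiber_sub_closure (open_nbhs_nbhs (conj oU Up))) cl.
have [|_ [[z Uz <-] Wz]] := closure_disjoint cl oW.
  by rewrite -[W _]/((b @^-1` W) x) WE.
have Vz : V (ext_in T z) by rewrite -[V _]/((ext_in T @^-1` V) z) -WE.
by have : (U `&` V) (ext_in T z) by []; rewrite UV.
Qed.

(** The topology of [T] at the added point is read off from the fiber.  From left
    to right, complete regularity of [T] gives a function that is 0 at the
    point and 1 off [U]; its restriction to [X] extends to [K], and the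
    extension vanishes on the fiber.  The converse is compactness of [K]. *)
Lemma nbhs_ext_ptP (T : one_point_extension X) (U : set T) :
  nbhs (ext_pt T) U <-> U (ext_pt T) /\
    exists O, [/\ open O, fiber T `<=` O & b @^-1` O `<=` ext_in T @^-1` U].
Proof.
split=> [nU|[Up [O [oO fO OU]]]].
  split; first exact: nbhs_singleton.
  have /nbhs_openP [V [oV Vp VU]] := nU.
  have [f [cf f01 fp fV]] :=
    completely_regular_urysohn R (ext_tychonoff T).2 oV Vp.
  have cfe : continuous (f \o ext_in T).
    by move=> x; apply: continuous_comp; [exact: ext_in_continuous|exact: cf].
  have [g cg gE] := ext_b cfe (fun x => f01 _).
  have gb x : g (b x) = f (ext_in T x) by rewrite -[LHS]/((g \o b) x) gE.
  exists [set y | g y < 1]; split; first exact: open_flt.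
    have nf : nbhs (ext_pt T) [set t | f t < 2^-1].
      by apply: open_nbhs_nbhs; split; [exact: open_flt|rewrite /= fp invr_gt0 ltr0n].
    move=> y /(fiber_sub_closure nf) cly.
    have : [set z | g z <= 2^-1] y.
      apply: (closure_min _ _ cly); first exact: closed_fle.
      by move=> _ [x fx <-] /=; rewrite gb ltW.
    by move=> /= /le_lt_trans; apply; rewrite invf_lt1 ?ltr1n.
  move=> x /=; rewrite gb => fx; apply: VU; apply: contrapT => /fV fx1.
  by rewrite fx1 ltxx in fx.
have [V nV VO] := compact_cluster_sub cK (trace_filter_proper T) oO fO.
apply: filterS nV; apply: ext_sub => // x Vx.
by apply: OU; apply: VO; exists x.
Qed.

(** The map underlying [ext_le] has no choice but to fix [X] and to send the
    added point to the added point, so only its continuity there matters; by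
    [nbhs_ext_ptP] it amounts to the inclusion of the fibers. *)
Lemma ext_leP (T1 T2 : one_point_extension X) : ext_le T2 T1 <-> fiber T1 `<=` fiber T2.
Proof.
split=> [[f cf fe] y f1y|f12].
  rewrite /fiber clusterE => A [U nU UA].
  have nfU : nbhs (ext_pt T1) (f @^-1` U).
    by have fp := ext_le_pt cf fe; apply: cf; rewrite fp.
  apply: (closureS _ (fiber_sub_closure nfU f1y)).
  by move=> _ [x fUx <-]; apply: UA; exists x; rewrite //= -fe.
have /choice [f fP] : forall t : T1, exists s : T2,
    (t = ext_pt T1 /\ s = ext_pt T2) \/ (exists x, t = ext_in T1 x /\ s = ext_in T2 x).
  move=> t; case: (ext_case t) => [->|[x ->]]; first by exists (ext_pt T2); left.
  by exists (ext_in T2 x); right; exists x.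
have fp : f (ext_pt T1) = ext_pt T2.
  by case: (fP (ext_pt T1)) => [[]//|[x [/esym/ext_in_neq_pt]]].
have fe x : f (ext_in T1 x) = ext_in T2 x.
  case: (fP (ext_in T1 x)) => [[/ext_in_neq_pt//]|[z [+ ->]]].
  by move/(ext_embedding T1).1 ->.
exists f => // t U; case: (ext_case t) => [->|[x ->]].
  rewrite fp => /nbhs_ext_ptP [Up [O [oO f2O OU]]]; apply/nbhs_ext_ptP.
  split; first by rewrite /= fp.
  exists O; split=> //; first exact: subset_trans f2O.
  by move=> x /OU /=; rewrite fe.
rewrite fe => /ext_in_continuous /nbhs_openP [V [oV Vx VU]].
apply/nbhs_openP; exists (ext_in T1 @` V); split.
- by apply: embedding_open_map => //; [exact: ext_embedding|exact: open_range_ext_in].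
- by exists x.
- by move=> _ [z Vz <-] /=; rewrite fe; exact: VU.
Qed.

End fibers.

(** * Collapsing a compact set to a point *)

Section collapse.
Context (R : realType) (X K : topologicalType) (b : X -> K).
Context (hK : hausdorff_space K) (cK : compact [set: K]).
Context (emb_b : embedding b) (dense_b : dense (range b)).
Context (open_b : open (range b)).
Context (C : set K) (clC : closed C) (C0 : C !=set0).
Context (C_notin : forall x, ~ C (b x)).

(** A function on [K] that is constant on [C] is, up to a constant, a function
    vanishing on [C]; the latter are easier to extend to the added point, by 0.
    They make up the coordinates of a map that collapses [C] to a point. *)
Definition vanishing : set (K -> R) :=
  [set g | continuous g /\ forall y, C y -> g y = 0].

Definition collapse_cube : uniformType := prod_topology (fun _ : vanishing => R).

Definition collapse (y : K) : collapse_cube := fun g => set_val g y.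

Definition collapse_option (t : option X) : collapse_cube :=
  if t is Some x then collapse (b x) else fun=> 0.

(** The set [X] with a point added, topologised as a subspace of the cube; being
    uniform, it is completely regular. *)
Definition collapse_space : uniformType := initial_topology collapse_option.

Definition collapse_in (x : X) : collapse_space := Some x.

Definition collapse_pt : collapse_space := None.

Lemma continuous_collapse : continuous collapse.
Proof.
by apply: continuous_prod => g; have /set_mem [cg _] := valP g.
Qed.

Lemma collapse_fiber y : C y -> collapse y = fun=> 0.
Proof.
by move=> Cy; apply/funext => g; have /set_mem [_] := valP g; exact.
Qed.

(** Coordinate functions of the cube.  The last clause records that they factor
    through [collapse_option], which is what makes them separate points. *)
Lemma vanishing_coord (g : K -> R) : vanishing g ->
  exists G : collapse_space -> R,
    [/\ continuous G, G collapse_pt = 0, forall x, G (collapse_in x) = g (b x) &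
        forall t t', collapse_option t = collapse_option t' -> G t = G t'].
Proof.
move=> vg; pose i : vanishing := exist _ g (mem_set vg).
exists (fun t => collapse_option t i); split=> // [t|t t' ->//].
apply: (@continuous_comp collapse_space collapse_cube R collapse_option (fun h => h i)).
  exact: initial_continuous.
exact: proj_continuous.
Qed.

Lemma closed_b x : closed [set b x].
Proof. by apply: accessible_closed_set1; exact: hausdorff_accessible. Qed.

Lemma collapse_option_inj : injective collapse_option.
Proof.
have sep (A : set K) x : closed A -> C `<=` A -> ~ A (b x) ->
    exists G : collapse_space -> R, [/\ continuous G, G collapse_pt = 0,
      G (collapse_in x) = 1, (forall x', A (b x') -> G (collapse_in x') = 0) &
      forall t t', collapse_option t = collapse_option t' -> G t = G t'].
  move=> clA CA nA.
  have [|g [cg g01 gA g1]] := compact_urysohn R hK cK clA (closed_b (x := x)).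
    by apply/seteqP; split=> // y [Ay yE]; apply: nA; rewrite -yE.
  have vg : vanishing g by split=> // y /CA /gA.
  have [G [cG Gp Gx Geq]] := vanishing_coord vg.
  exists G; split=> //; first by rewrite Gx g1.
  by move=> x' Ax'; rewrite Gx gA.
have neqp x : collapse_option (Some x) <> collapse_option None.
  move=> E; have [//|G [_ Gp Gx _ /(_ _ _ E) GE]] := sep C x clC _ (@C_notin x).
  move: GE; rewrite -[Some x]/(collapse_in x) Gx -[None]/collapse_pt Gp.
  by move/eqP; rewrite oner_eq0.
move=> [x|] [x'|] // E; last 2 first.
- by case: (neqp x).
- by case: (neqp x').
congr Some; apply: contrapT => xx'.
have [|||G [_ _ Gx Gx' /(_ _ _ E) GE]] := sep (C `|` [set b x']) x.
- by apply: closedU => //; exact: closed_b.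
- exact: subsetUl.
- by move=> [/C_notin//|/emb_b.1].
move: GE; rewrite -[Some x]/(collapse_in x) Gx -[Some x']/(collapse_in x') Gx'.
  by move/eqP; rewrite oner_eq0.
by right.
Qed.

Lemma collapse_hausdorff : hausdorff_space collapse_space.
Proof.
apply: (@hausdorff_injective collapse_space collapse_cube collapse_option).
- exact: initial_continuous.
- exact: collapse_option_inj.
- by apply: hausdorff_product => _; exact: Rhausdorff.
Qed.

Lemma collapse_tychonoff : tychonoff_space collapse_space.
Proof.
split; first exact: collapse_hausdorff.
exact: (@uniform_completely_regular R).
Qed.

Lemma continuous_collapse_in : continuous collapse_in.
Proof.
apply: (@continuous_comp_initial _ X collapse_cube collapse_option).
move=> x; apply: (@continuous_comp X K collapse_cube b collapse).
  exact: embedding_continuous emb_b x.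
exact: continuous_collapse.
Qed.

(** Since [X] is open in [K], the Urysohn function that is 1 at [b x] and 0 off
    [b @` U] vanishes on [C], hence is one of the coordinates. *)
Lemma open_collapse_in (U : set X) : open U -> open (collapse_in @` U).
Proof.
move=> oU; rewrite openE => _ [x Ux <-].
have obU := embedding_open_map emb_b open_b oU.
have [|g [cg g01 g0 g1]] :=
    compact_urysohn R hK cK (open_closedC obU) (closed_b (x := x)).
  by apply/seteqP; split=> // y [nbU yE]; apply: nbU; rewrite yE; exists x.
have [|G [cG Gp Gx _]] := @vanishing_coord g.
  by split=> // y Cy; apply: g0 => -[x' _ x'E]; apply: (@C_notin x'); rewrite x'E.
have : open_nbhs (collapse_in x) [set t | 0 < G t].
  by split; [exact: open_fgt|rewrite /= Gx g1].
move/open_nbhs_nbhs; apply: filterS => -[x'|] /=.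
  rewrite -[Some x']/(collapse_in x') Gx => gx'; exists x' => //.
  apply: contrapT => nUx'; rewrite g0 ?ltxx // in gx'.
  by move=> [x'' Ux'' /emb_b.1 xx]; apply: nUx'; rewrite -xx.
by rewrite -[None]/collapse_pt Gp ltxx.
Qed.

Lemma embedding_collapse_in : embedding collapse_in.
Proof.
split; first by move=> x y [].
move=> U; split=> [oU|[V oV <-]].
  exists (collapse_in @` U); first exact: open_collapse_in.
  by apply/seteqP; split=> [x [x' Ux' [<-]]//|x Ux]; exists x.
by apply: open_comp => // x _; exact: continuous_collapse_in.
Qed.

(** The preimage under [collapse] of an open set of the cube is open in [K] and
    has the right trace, because [collapse] is constant on [C] with the value
    given to the added point. *)
Lemma collapse_trace (U : set collapse_space) : nbhs collapse_pt U ->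
  exists O, [/\ open O, C `<=` O & b @^-1` O `<=` collapse_in @^-1` U].
Proof.
move=> /nbhs_openP [_ [[V oV <-] Vp VU]].
exists (collapse @^-1` V); split.
- by apply: open_comp => // y _; exact: continuous_collapse.
- by move=> y Cy /=; rewrite collapse_fiber.
- by move=> x Vx; apply: VU.
Qed.

Lemma dense_collapse_in : dense (range collapse_in).
Proof.
move=> O [[x Ox _|Op oO]]; first by exists (Some x); split=> //; exists x.
have [W [oW CW WO]] := collapse_trace (open_nbhs_nbhs (conj oO Op)).
have [c Cc] := C0.
have [|y [Wy [x _ xE]]] := dense_b _ oW; first by exists c; exact: CW.
by exists (collapse_in x); split; [apply: WO; rewrite /= xE|exists x].
Qed.

Lemma collapse_remainder : ~` range collapse_in = [set collapse_pt].
Proof.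
apply/seteqP; split=> [[x []|//]|_ -> [x _]//].
by exists x.
Qed.

Definition collapse_extension : one_point_extension X :=
  OnePointExtension collapse_tychonoff embedding_collapse_in dense_collapse_in
    collapse_remainder.

Lemma fiber_collapse : fiber b collapse_extension = C.
Proof.
apply/seteqP; split=> y.
  apply: contraPP => nCy fy.
  have [|g [cg g01 g0 g1]] := compact_urysohn R hK cK clC
      (accessible_closed_set1 (hausdorff_accessible hK) (x := y)).
    by apply/seteqP; split=> // z [Cz zE]; apply: nCy; rewrite -zE.
  have [//|G [cG Gp Gx _]] := @vanishing_coord g.
  have nU : nbhs (ext_pt collapse_extension) [set t | G t < 2^-1].
    by apply: open_nbhs_nbhs; split; [exact: open_flt|rewrite /= Gp invr_gt0 ltr0n].
  have cly := fiber_sub_closure nU fy.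
  have [|_ [[x Ux <-] /= gx]] := closure_disjoint cly (open_fgt cg 2^-1).
    by rewrite /= g1 // invf_lt1 ?ltr1n.
  by move: Ux; rewrite /= Gx => /(lt_trans gx); rewrite ltxx.
move=> Cy A N [U nU UA] /nbhs_openP [V [oV Vy VN]].
have [W [oW CW WU]] := collapse_trace nU.
have [|z [[Wz Vz] [x _ xE]]] := dense_b _ (openI oW oV).
  by exists y; split=> //; exact: CW.
exists (b x); split; last by apply: VN; rewrite xE.
by apply: UA; exists x => //; apply: WU; rewrite /= xE.
Qed.

End collapse.

(** * Sigma-compact sets *)

Section sigma_compact_sets.
Context (X Y : topologicalType).

Lemma sigma_compactU (A B : set X) :
  sigma_compact A -> sigma_compact B -> sigma_compact (A `|` B).
Proof.
move=> [K cK ->] [L cL ->]; exists (fun n => K n `|` L n).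
  by move=> n; exact: compactU.
by rewrite bigcupU.
Qed.

Lemma sigma_compact_image (f : X -> Y) (A : set X) :
  continuous f -> sigma_compact A -> sigma_compact (f @` A).
Proof.
move=> cf [K cK ->]; exists (fun n => f @` K n); last by rewrite image_bigcup.
by move=> n; apply: continuous_compact => //; exact: continuous_subspaceT.
Qed.

Lemma sigma_compact_preimage (e : X -> Y) (A : set Y) :
  embedding e -> A `<=` range e -> sigma_compact A -> sigma_compact (e @^-1` A).
Proof.
move=> emb Ae [K cK AE]; exists (fun n => e @^-1` K n); last first.
  by rewrite AE preimage_bigcup.
move=> n; apply: (compact_initial (embedding_open emb)).
rewrite (_ : e @` _ = K n) //.
apply/seteqP; split=> [_ [x Kx <-//]|y Ky].
have [|x _ xy] := Ae y; first by rewrite AE; exists n.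
by exists x => //=; rewrite xy.
Qed.

End sigma_compact_sets.

Section sigma_compact_hull.
Context (X : topologicalType).

(** Apply near-covering compactness to the filter of the subfamilies that contain
    all but finitely many members of [D]. *)
Lemma locally_finite_compact (D : set (set X)) (K : set X) :
  locally_finite D -> compact K -> finite_set (D `&` [set A | A `&` K !=set0]).
Proof.
move=> lfD /compact_near_coveringP cK.
pose F : set_system (set X) := [set P | finite_set (D `\` P)].
have FF : Filter F.
  split; first by rewrite /F /= setDT.
    by move=> P Q fP fQ; rewrite /F /= setDIr finite_setU.
  by move=> P Q PQ; apply: sub_finite_set; exact: setDS.
have near_F : F [set A | K `<=` [set x | D A -> ~ A x]].
  apply: (cK _ F (fun A x => D A -> ~ A x) FF) => x _; have [U nU fU] := lfD x.
  exists (U, ~` (D `&` [set A | A `&` U !=set0])) => /=.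
    split=> //; rewrite /F /=; apply: sub_finite_set fU => A [DA].
    by move/contrapT.
  by move=> [y A] [/= Uy nA] DA Ay; apply: nA; split=> //; exists y.
apply: sub_finite_set near_F => A [DA [x [Ax Kx]]]; split=> //= KA.
exact: KA Kx DA Ax.
Qed.

Lemma compact_bigcup_finite (I : choiceType) (D : set I) (F : I -> set X) :
  finite_set D -> (forall i, D i -> compact (F i)) -> compact (\bigcup_(i in D) F i).
Proof.
move=> fD cF; rewrite -bigsetU_fset_set // big_seq.
by apply: bigsetU_compact => i; rewrite in_fset_set // inE => /cF.
Qed.

Lemma relatively_compact_cover :
  locally_compact_space X -> paracompact_space X ->
  exists D : set (set X), [/\ forall A, D A -> open A, forall x, exists2 A, D A & A x,
    forall A, D A -> compact (closure A) & locally_finite D].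
Proof.
move=> [hX lcX] [_ pcX].
pose C := [set U : set X | open U /\ exists2 N, compact N & U `<=` N].
have covC : \bigcup_(A in C) A = setT.
  apply/seteqP; split=> // x _; have [N nN [cN _]] := lcX x I.
  have /nbhs_openP [U [oU Ux UN]] : nbhs x N.
    by move: nN; rewrite /within /=; apply: filterS => y; apply.
  by exists U => //; split=> //; exists N.
have [|D [oD covD DC lfD]] := pcX C _ covC; first by move=> U [].
exists D; split=> //.
  by move=> x; have : [set: X] x by []; rewrite -covD => -[A]; exists A.
move=> A /DC [U [_ [N cN UN]] AU].
apply: (subclosed_compact _ cN); first exact: closed_closure.
by apply: closure_min; [exact: compact_closed|exact: subset_trans UN].
Qed.

(** Take a locally finite open cover by relatively compact sets.  The star of a
    compact set, made of the closures of the members of the cover meeting it,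
    is compact.  The union of all iterated stars of the compact pieces of [A]
    is open because a member of the cover meeting one of them lies in the next,
    and closed for the same reason. *)
Lemma sigma_compact_clopen_hull (A : set X) :
  locally_compact_space X -> paracompact_space X -> sigma_compact A ->
  exists B, [/\ clopen B, sigma_compact B & A `<=` B].
Proof.
move=> lcX pcX [K cK ->].
have [D [oD covD cD lfD]] := relatively_compact_cover lcX pcX.
pose star (L : set X) := \bigcup_(A in D `&` [set A | A `&` L !=set0]) closure A.
have c_star L : compact L -> compact (star L).
  move=> cL; apply: compact_bigcup_finite; first exact: locally_finite_compact.
  by move=> U [/cD].
have star_mem U L x y : D U -> U x -> L x -> U y -> star L y.
  by move=> DU Ux Lx Uy; exists U; [split=> //; exists x|exact: subset_closure].
(* The stars are indexed by pairs; [pickle] turns the double union into a sequence. *)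
pose H k := if unpickle k is Some (m, n) then iter m star (K n) else set0.
have H_mem m n x : iter m star (K n) x -> (\bigcup_k H k) x.
  by move=> Hx; exists (pickle (m, n)) => //; rewrite /H pickleK.
have H_inv x : (\bigcup_k H k) x -> exists m n, iter m star (K n) x.
  by move=> [k _]; rewrite /H; case: unpickle => // -[m n]; exists m, n.
exists (\bigcup_k H k); split.
- split.
    rewrite openE => x /H_inv [m [n Hx]]; have [U DU Ux] := covD x.
    apply: filterS (open_nbhs_nbhs (conj (oD U DU) Ux)) => y Uy.
    by apply: (H_mem m.+1 n); exact: (star_mem U _ x).
  move=> x clx; have [U DU Ux] := covD x.
  have [y [/H_inv [m [n Hy]] Uy]] := clx _ (open_nbhs_nbhs (conj (oD U DU) Ux)).
  by apply: (H_mem m.+1 n); exact: (star_mem U _ y).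
- exists H => // k; rewrite /H; case: unpickle => [[m n]|]; last exact: compact0.
  by elim: m => //= m IHm; exact: c_star.
- by move=> x [n _ Kx]; apply: (H_mem 0%N n).
Qed.

End sigma_compact_hull.

(** * Extensions with compact G-delta fibers in the sigma-remainder *)

Section correspondence.
(* [K] stands for the Stone-Cech compactification of [X], of which only these
   properties matter. *)
Context (R : realType) (X K : topologicalType) (b : X -> K).
Context (hK : hausdorff_space K) (cK : compact [set: K]).
Context (emb_b : embedding b) (dense_b : dense (range b)) (open_b : open (range b)).
Context (ext_b : forall f : X -> R, continuous f -> (forall x, 0 <= f x <= 1) ->
  exists2 g : K -> R, continuous g & g \o b = f).
Context (hull : forall A : set X, sigma_compact A ->
  exists B, [/\ clopen B, sigma_compact B & A `<=` B]).

(** [sigma_remainder] for the inclusion [b] in place of the canonical map to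
    [beta]. *)
Definition sigma_rem : set K :=
  \bigcup_(A in [set A : set X | sigma_compact A]) closure (b @` A) `\` range b.

Definition TstarS_extension (T : one_point_extension X) : Prop :=
  first_countable_at (ext_pt T) /\
  exists2 U, nbhs (ext_pt T) U & sigma_compact (U `\ ext_pt T).

(** The indicator function of [B] is continuous; its extension to [K] is the
    indicator of the closure of [B]. *)
Lemma clopen_closure (B : set X) : clopen B ->
  open (closure (b @` B)) /\ forall x, closure (b @` B) (b x) -> B x.
Proof.
move=> [oB clB]; pose f x : R := if x \in B then 1 else 0.
have fB x : B x -> f x = 1 by move=> Bx; rewrite /f mem_set.
have fnB x : ~ B x -> f x = 0 by move=> Bx; rewrite /f memNset.
have cf : continuous f.
  move=> x; have [Bx|nBx] := pselect (B x).
    apply: cvg_near_cst; apply: filterS (open_nbhs_nbhs (conj oB Bx)) => y By.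
    by rewrite !fB.
  apply: cvg_near_cst.
  apply: filterS (open_nbhs_nbhs (conj (closed_openC clB) nBx)) => y By.
  by rewrite !fnB.
have [|g cg gE] := ext_b cf.
  by move=> x; rewrite /f; case: ifP; rewrite ?lexx ler01.
have gb x : g (b x) = f x by rewrite -[LHS]/((g \o b) x) gE.
have cl1 : closure (b @` B) `<=` [set y | g y = 1].
  apply: closure_min; first exact: closed_feq.
  by move=> _ [x Bx <-] /=; rewrite gb fB.
split; last first.
  move=> x /cl1 /=; rewrite gb => fx; apply: contrapT => /fnB; rewrite fx.
  by move/eqP; rewrite oner_eq0.
suff -> : closure (b @` B) = [set y | 0 < g y] by exact: open_fgt.
apply/seteqP; split=> [y /cl1 /= ->|y /= gy]; first exact: ltr01.
apply: closureS (dense_open_closure dense_b (open_fgt cg 0) gy).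
move=> z [gz [x _ xE]]; exists x => //; rewrite -xE /= gb in gz.
by apply: contrapT => /fnB fx0; rewrite fx0 ltxx in gz.
Qed.

(** The closures of the sigma-compact sets form a directed family and, thanks to
    the clopen hulls, their interiors already cover, so compactness selects
    one. *)
Lemma compact_sub_clopen_closure (C : set K) : compact C -> C `<=` sigma_rem ->
  exists B, [/\ clopen B, sigma_compact B & C `<=` closure (b @` B)].
Proof.
move=> /compact_near_coveringP cC CS.
pose F := filter_from [set A : set X | sigma_compact A] (fun A => [set A' | A `<=` A']).
have FF : Filter F.
  apply: filter_from_filter.
    by exists set0; exists (fun=> set0); [move=> _; exact: compact0|rewrite bigcup0].
  move=> A B sA sB; exists (A `|` B); first exact: sigma_compactU.
  by move=> A' /=; rewrite subUset.
have [A sA CA] : F [set A | C `<=` closure (b @` A)].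
  apply: (cC _ F (fun A y => closure (b @` A) y)) => y /CS [[A sA cly] _].
  have [B [clB sB AB]] := hull sA.
  have [ocl _] := clopen_closure clB.
  exists (closure (b @` B), [set A' | B `<=` A']) => /=.
    split; last by exists B.
    by apply: open_nbhs_nbhs; split=> //; apply: closureS cly; exact: image_subset.
  move=> [y' A'] [/= By' BA']; apply: closureS By'; exact: image_subset.
have [B [clB sB AB]] := hull sA.
exists B; split=> //; apply: subset_trans (CA A (@subset_refl _ A)) _.
by apply: closureS; exact: image_subset.
Qed.

Lemma compact_sigma_rem_preimage (C : set K) : closed C -> C `<=` sigma_rem ->
  compact (set_val @^-1` C : set (set_type sigma_rem)).
Proof.
move=> clC CS; apply: (@compact_initial _ K set_val) => //.
rewrite (_ : _ @` _ = C); first exact: subclosed_compact cK _.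
apply/seteqP; split=> [_ [s Cs <-//]|y Cy].
by exists (exist _ y (mem_set (CS y Cy))).
Qed.

Lemma TstarS_fiber_sub T : TstarS_extension T -> fiber b T `<=` sigma_rem.
Proof.
move=> [_ [U nU sU]] y fy; split; last first.
  by move=> [x _ xE]; apply: (fiber_notin emb_b (T := T) (x := x)); rewrite xE.
exists (ext_in T @^-1` (U `\ ext_pt T)).
  apply: sigma_compact_preimage => //; first exact: ext_embedding.
  by move=> t [_ nt]; case: (ext_case t) => [/nt//|[x ->]]; exists x.
apply: closureS (fiber_sub_closure nU fy); apply: image_subset => x Ux.
by split=> //; exact: ext_in_neq_pt.
Qed.

(** A countable neighbourhood base of the added point yields, by [nbhs_ext_ptP],
    countably many open sets around the fiber.  A point common to all of them
    lies in the closure of the trace of every neighbourhood, by density of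
    [X]. *)
Lemma TstarS_fiber_compact_Gdelta T : TstarS_extension T ->
  is_compact_Gdelta (set_val @^-1` (fiber b T) : set (set_type sigma_rem)).
Proof.
move=> gT; have fS := TstarS_fiber_sub gT; split.
- have [y fy] := fiber_neq0 b cK T.
  by exists (exist _ y (mem_set (fS y fy))).
- by apply: compact_sigma_rem_preimage => //; exact: fiber_closed.
apply: Gdelta_preimage; first exact: set_val_continuous.
case: gT => -[B nB Bbase] _.
have /choice [O OP] : forall n, exists O,
    [/\ open O, fiber b T `<=` O & b @^-1` O `<=` ext_in T @^-1` (B n)].
  by move=> n; have [_] := (nbhs_ext_ptP cK ext_b _).1 (nB n).
exists O; first by move=> n; have [] := OP n.
apply/seteqP; split=> [y fy n _|y Oy]; first by have [_ + _] := OP n; exact.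
rewrite /fiber clusterE => A [U nU UA].
have [n BU] := Bbase _ nU; have [oO _ OB] := OP n.
apply: closureS (dense_open_closure dense_b oO (Oy n I)).
move=> z [Oz [x _ xE]]; rewrite -xE; apply: UA; exists x => //; apply: BU; apply: OB.
by rewrite /= xE.
Qed.

(** Let [B] be a clopen sigma-compact set whose closure contains the given set.
    Within that closure, the remainder is obtained by removing the
    sigma-compact set [B], so a G-delta of the remainder is a G-delta of [K]:
    the collapsed extension is then first countable at its point.  Adding [B] to
    the point gives the sigma-compact neighbourhood. *)
Lemma compact_Gdelta_fiber (D : compact_Gdelta (set_type sigma_rem)) :
  exists T, TstarS_extension T /\ set_val @^-1` (fiber b T) = sval D.
Proof.
have [[s0 Ds0] cD [P oP DP]] := svalP D; set C := set_val @` sval D.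
have CS : C `<=` sigma_rem by move=> _ [s _ <-]; exact: set_valP.
have cC : compact C.
  apply: continuous_compact => //; apply: continuous_subspaceT.
  exact: set_val_continuous.
have clC : closed C by exact: compact_closed.
have C0 : C !=set0 by exists (set_val s0); exists s0.
have C_notin x : ~ C (b x) by move=> /CS [_]; apply; exists x.
have CD : set_val @^-1` C = sval D.
  by apply/seteqP; split=> [s [s' Ds' /val_inj <-//]|s Ds]; exists s.
have [B [clB sB CB]] := compact_sub_clopen_closure cC CS.
have [oclB clBb] := clopen_closure clB.
have GC : Gdelta C.
  have /choice [Q QP] : forall n, exists Q, open Q /\ set_val @^-1` Q = P n.
    by move=> n; have [Q oQ QE] := oP n; exists Q.
  have [L cL BL] := sB.
  exists (fun n => (Q n `&` closure (b @` B)) `&` ~` (b @` (L n))).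
    move=> n; apply: openI; first by apply: openI => //; have [] := QP n.
    apply: closed_openC; apply: compact_closed => //.
    apply: continuous_compact => //; apply: continuous_subspaceT.
    exact: embedding_continuous.
  apply/seteqP; split=> [_ [s Ds <-] n _|y Qy].
    split; last by move=> [x Lx xE]; have [_] := set_valP s; apply; exists x.
    split; last by apply: CB; exists s.
    have [_ QE] := QP n; rewrite -[Q n _]/((set_val @^-1` Q n) s) QE.
    by move: Ds; rewrite DP; apply.
  have [[_ cly] _] := Qy 0%N I.
  have Sy : sigma_rem y.
    split; first by exists B.
    move=> [x _ xE]; move: cly; rewrite -xE => /clBb; rewrite BL => -[n _ Lx].
    by have [_] := Qy n I; apply; exists x.
  exists (exist _ y (mem_set Sy)) => //; rewrite DP => n _.
  by have [_ <-] := QP n; have [[]] := Qy n I.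
pose T := collapse_extension R hK cK emb_b dense_b open_b clC C0 C_notin
  : one_point_extension X.
have fT : fiber b T = C by exact: fiber_collapse.
exists T; rewrite fT; split=> //; split.
  have [W WP Wbase] := closed_Gdelta_nbhs_base hK cK clC GC.
  exists (fun n => [set ext_pt T] `|` ext_in T @` (b @^-1` (W n))).
    move=> n; apply/(nbhs_ext_ptP cK ext_b); split; first by left.
    have [oW CW] := WP n; exists (W n); split=> //; first by rewrite fT.
    by move=> x Wx; right; exists x.
  move=> U /(nbhs_ext_ptP cK ext_b) [Up [O [oO fO OU]]].
  have [|n WO] := Wbase O oO; first by rewrite -fT.
  exists n => _ [->//|[x Wx <-]]; apply: OU; exact: WO.
exists ([set ext_pt T] `|` ext_in T @` B).
  apply/(nbhs_ext_ptP cK ext_b); split; first by left.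
  exists (closure (b @` B)); split=> //; first by rewrite fT.
  by move=> x /clBb Bx; right; exists x.
rewrite (_ : _ `\ _ = ext_in T @` B).
  by apply: sigma_compact_image => //; exact: ext_in_continuous.
apply/seteqP; split=> [t [[->|//] []//]|_ [x Bx <-]].
by split; [right; exists x|exact: ext_in_neq_pt].
Qed.

Lemma sigma_rem_hausdorff : hausdorff_space (set_type sigma_rem).
Proof.
apply: (@hausdorff_injective _ K set_val _ _ hK); first exact: set_val_continuous.
exact: val_inj.
Qed.

(** A point of the remainder lies in the closure of a clopen sigma-compact [B]; that
    closure is clopen and its part in the remainder is compact, [X] being open
    in [K].  Cutting it down by a sublevel set of a Urysohn function keeps it a
    compact G-delta. *)
Lemma sigma_rem_base : has_compact_Gdelta_base (set_type sigma_rem).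
Proof.
move=> s V [V' oV' <-] V's.
have [[A sA cls] nbs] := set_valP s; have [B [clB sB AB]] := hull sA.
have [oclB clBb] := clopen_closure clB.
have Bs : closure (b @` B) (set_val s) by apply: closureS cls; exact: image_subset.
have crK : completely_regular_space K.
  apply: (@normal_completely_regular R); first exact: compact_normal.
  exact: hausdorff_accessible.
have [f [cf f01 fs fV]] := completely_regular_urysohn R crK oV' V's.
have cfs : continuous (f \o set_val : sigma_rem -> R).
  by move=> x; apply: continuous_comp; [exact: set_val_continuous|exact: cf].
pose N : set (set_type sigma_rem) := set_val @^-1` closure (b @` B).
have oN : open N by exists (closure (b @` B)).
pose Z : set (set_type sigma_rem) := N `&` [set s | (f \o set_val) s <= 2^-1].
have nZ : nbhs s Z.
  apply: filterI; first exact: open_nbhs_nbhs.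
  have : nbhs s [set s | (f \o set_val : sigma_rem -> R) s < 2^-1].
    apply: open_nbhs_nbhs; split; first exact: open_flt.
    by rewrite /= fs invr_gt0 ltr0n.
  by apply: filterS => t /= /ltW.
pose C := closure (b @` B) `&` [set y | f y <= 2^-1] `&` ~` range b.
have clC : closed C.
  apply: closedI; last exact: open_closedC.
  by apply: closedI; [exact: closed_closure|exact: closed_fle].
have CS : C `<=` sigma_rem by move=> y [[cly _] nby]; split=> //; exists B.
have cZ : is_compact_Gdelta Z.
  split; first by exists s; exact: nbhs_singleton.
    rewrite (_ : Z = set_val @^-1` C); first exact: compact_sigma_rem_preimage.
    apply/seteqP; split=> t; first by move=> [Nt ft]; split=> //; have [_] := set_valP t.
    by move=> [].
  apply: GdeltaI; last exact: Gdelta_fle.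
  exact: open_Gdelta.
exists (exist _ _ cZ); split=> // t [_ /= ft].
apply: contrapT => /fV ft1; move: ft; rewrite ft1.
by rewrite leNgt invf_lt1 ?ltr1n.
Qed.

(** A class of extensions is sent to the fiber of any of its members. *)
Lemma TstarS_compact_Gdelta_order :
  order_isomorphic (TstarS_le X) (@compact_Gdelta_ge (set_type sigma_rem)).
Proof.
have /choice [F FP] : forall c : TstarS X, exists D : compact_Gdelta (set_type sigma_rem),
    exists T, [/\ sval (sval c) = ext_equiv T, TstarS_extension T &
                  set_val @^-1` (fiber b T) = sval D].
  move=> [[C [T0 CT0]] [T [/= CT fcT sT]]].
  have gT : TstarS_extension T by [].
  exists (exist _ _ (TstarS_fiber_compact_Gdelta gT)), T; split=> //=.
  rewrite CT0 in CT *; apply: funext => T'; apply: propext; split.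
    exact/ext_equiv_trans/ext_equiv_sym.
  exact: ext_equiv_trans.
have F_le (c2 c1 : TstarS X) : TstarS_le X c2 c1 <-> compact_Gdelta_ge (F c2) (F c1).
  have [T2 [cT2 gT2 FT2]] := FP c2; have [T1 [cT1 gT1 FT1]] := FP c1.
  rewrite /TstarS_le /ext_class_le /compact_Gdelta_ge -FT2 -FT1 cT2 cT1.
  have -> : (set_val @^-1` fiber b T1 : set (set_type sigma_rem)) `<=`
      set_val @^-1` fiber b T2 <-> ext_le T2 T1.
    rewrite (ext_leP cK ext_b); split=> [f12 y f1y|f12 s /f12//].
    exact: (f12 (exist _ y (mem_set (TstarS_fiber_sub gT1 f1y)))).
  split=> [[T2' [T1' [/ext_equiv_le [_ l2] /ext_equiv_le [l1 _] l12]]]|l12].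
    exact: ext_le_trans (ext_le_trans l2 l12) l1.
  by exists T2, T1; split=> //; exact: ext_equiv_refl.
apply: (order_isomorphic_embed (f := F)) F_le.
  move=> c c' Fcc'; do 2![apply: sval_inj].
  have [T [-> gT FT]] := FP c; have [T' [-> gT' FT']] := FP c'.
  have fTT' : fiber b T = fiber b T'.
    have fE (T1 T2 : one_point_extension X) : TstarS_extension T1 ->
        set_val @^-1` (fiber b T1) = set_val @^-1` (fiber b T2) :>
          set (set_type sigma_rem) ->
        fiber b T1 `<=` fiber b T2.
      move=> g1 E y f1y.
      pose s : set_type sigma_rem := exist _ y (mem_set (TstarS_fiber_sub g1 f1y)).
      by have : (set_val @^-1` fiber b T1) s by []; rewrite E.
    by apply/seteqP; split; apply: fE => //; rewrite FT FT' Fcc'.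
  have eTT' : ext_equiv T T'.
    by apply: ext_le_anti; apply/(ext_leP cK ext_b); rewrite fTT'.
  apply: funext => T''; apply: propext; split.
    exact/ext_equiv_trans/ext_equiv_sym.
  exact: ext_equiv_trans.
move=> D; have [T [gT TD]] := compact_Gdelta_fiber D.
have in_T : in_TstarS (exist _ (ext_equiv T) (ex_intro _ T erefl)).
  by exists T; case: gT => fcT sT; split=> //=; exact: ext_equiv_refl.
exists (exist _ _ in_T); apply: sval_inj; rewrite -TD.
have [T' [/= TT' gT' <-]] := FP (exist _ _ in_T).
have /ext_equiv_le [l1 l2] : ext_equiv T' T.
  by rewrite -TT'; exact: ext_equiv_refl.
have f12 := (ext_leP cK ext_b _ _).1 l1; have f21 := (ext_leP cK ext_b _ _).1 l2.
by apply/seteqP; split=> s; [exact: f12|exact: f21].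
Qed.

End correspondence.

(** * The Stone-Cech compactification *)

Section stone_cech_facts.
Context (R : realType) (X : topologicalType).

Local Notation b := (@beta_in R X).

Lemma beta_hausdorff : hausdorff_space (beta R X).
Proof.
apply: (@hausdorff_injective _ (unit_product R X) set_val).
- exact: set_val_continuous.
- exact: val_inj.
- by apply: hausdorff_product => _; exact: Rhausdorff.
Qed.

Lemma beta_compact : compact [set: beta R X].
Proof.
apply: (@compact_initial _ (unit_product R X) set_val) => //.
have cube : compact [set f : unit_product R X | forall i, `[0%R, 1%R]%classic (f i)].
  apply: (@tychonoff (unit_functions R X : choiceType) (fun=> R : topologicalType)
    (fun=> `[0%R, 1%R]%classic)) => _.
  exact: segment_compact.
apply: (subclosed_compact _ cube).
  rewrite (_ : _ @` _ = closure (range (@cube_eval R X))); first exact: closed_closure.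
  apply/seteqP; split=> [_ [y _ <-]|y cly]; first exact: set_valP.
  by exists (exist _ y (mem_set cly)).
move=> _ [y _ <-] i.
have : closure (range (@cube_eval R X)) (set_val y) by exact: set_valP.
have clI : closed [set f : unit_product R X | `[0%R, 1%R]%classic (f i)].
  apply: (@preimage_closed _ _ (fun f : unit_product R X => f i) `[0, 1]%classic).
    by move=> f _; exact: proj_continuous.
  by apply: compact_closed; [exact: Rhausdorff|exact: segment_compact].
apply: (closure_min clI) => _ [x _ <-] /=.
by have /set_mem [_ f01] := valP i; rewrite in_itv; exact: f01.
Qed.

Lemma beta_extension (f : X -> R) : continuous f -> (forall x, 0 <= f x <= 1) ->
  exists2 g : beta R X -> R, continuous g & g \o b = f.
Proof.
move=> cf f01; pose i : unit_functions R X := exist _ f (mem_set (conj cf f01)).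
exists (fun y => set_val y i) => // y.
apply: (@continuous_comp (beta R X) (unit_product R X) R set_val (fun h => h i)).
  exact: set_val_continuous.
exact: proj_continuous.
Qed.

Lemma beta_in_continuous : continuous b.
Proof.
apply: (@continuous_comp_initial _ X (unit_product R X) set_val).
by apply: continuous_prod => i; have /set_mem [] := valP i.
Qed.

Lemma beta_in_dense : dense (range b).
Proof.
move=> O [y Oy] [V oV VO].
have cly : closure (range (@cube_eval R X)) (set_val y) by exact: set_valP.
have Vy : V (set_val y) by rewrite -VO in Oy.
have [_ [[x _ <-] Vx]] := closure_disjoint cly oV Vy.
by exists (b x); split; [rewrite -VO|exists x].
Qed.

Lemma beta_in_embedding : tychonoff_space X -> embedding b.
Proof.
move=> [hX crX].
have sep x (U : set X) : open U -> U x ->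
    exists2 V : set (beta R X), open V & V (b x) /\ b @^-1` V `<=` U.
  move=> oU Ux; have [f [cf f01 fx fU]] := completely_regular_urysohn R crX oU Ux.
  have [g cg gE] := beta_extension cf f01.
  have gb z : g (b z) = f z by rewrite -[LHS]/((g \o b) z) gE.
  exists [set y | g y < 1]; first exact: open_flt.
  split=> [|z /=]; first by rewrite /= gb fx.
  by rewrite gb => fz; apply: contrapT => /fU fz1; rewrite fz1 ltxx in fz.
split.
  move=> x y bxy; apply: contrapT => xy.
  have oy : open (~` [set y]).
    by apply: closed_openC; apply: accessible_closed_set1; exact: hausdorff_accessible.
  have [V oV [Vx VU]] := sep x _ oy xy.
  by rewrite bxy in Vx; exact: (VU y Vx).
move=> U; split=> [oU|[V oV <-]]; last first.
  by apply: open_comp => // x _; exact: beta_in_continuous.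
exists (\bigcup_(V in [set V | open V /\ b @^-1` V `<=` U]) V).
  by apply: bigcup_open => V [].
apply/seteqP; split=> [x [V [_ VU] Vx]|x Ux]; first exact: VU.
by have [V oV [Vx VU]] := sep x U oU Ux; exists V.
Qed.

(** A compact neighbourhood [N] of [x] is closed in the compactification; an open
    set with trace inside [N] lies, by density, in the closure of that trace,
    hence in [N]. *)
Lemma open_range_beta_in : locally_compact_space X -> open (range b).
Proof.
move=> [hX lcX].
have emb : embedding b.
  apply: beta_in_embedding; split=> //.
  exact: (@locally_compact_completely_regular X R).
rewrite openE => _ [x _ <-]; have [N nN [cN _]] := lcX x I.
have /nbhs_openP [U [oU Ux UN]] : nbhs x N.
  by move: nN; rewrite /within /=; apply: filterS => y; apply.
have [V oV VU] := embedding_open emb oU.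
have clbN : closed (b @` N).
  apply: compact_closed; first exact: beta_hausdorff.
  apply: continuous_compact => //; apply: continuous_subspaceT.
  exact: beta_in_continuous.
have Vx : V (b x) by rewrite -[V _]/((b @^-1` V) x) VU.
apply: filterS (open_nbhs_nbhs (conj oV Vx)) => y Vy.
suff : (b @` N) y by move=> [z _ <-]; exists z.
apply: (closure_min clbN _ (dense_open_closure beta_in_dense oV Vy)).
move=> z [Vz [w _ wz]]; exists w => //; apply: UN.
by rewrite -VU /= wz.
Qed.

End stone_cech_facts.

(** * The theorem *)

Section sigma_remainder_facts.
Context (R : realType) (X : topologicalType).
Context (lcX : locally_compact_space X) (pcX : paracompact_space X).

Local Notation S := (set_type (sigma_remainder R X)).

Let embX : embedding (@beta_in R X).
Proof.
apply: beta_in_embedding; case: lcX => hX lX; split=> //.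
exact: (@locally_compact_completely_regular X R).
Qed.

Let hullX (A : set X) : sigma_compact A ->
  exists B, [/\ clopen B, sigma_compact B & A `<=` B].
Proof. exact: sigma_compact_clopen_hull. Qed.

Lemma TstarS_sigma_remainder_order :
  order_isomorphic (TstarS_le X) (@compact_Gdelta_ge S).
Proof.
exact: (TstarS_compact_Gdelta_order (@beta_hausdorff R X) (@beta_compact R X) embX
  (@beta_in_dense R X) (open_range_beta_in R lcX) (@beta_extension R X) hullX).
Qed.

Lemma sigma_remainder_hausdorff : hausdorff_space S.
Proof. exact: sigma_rem_hausdorff (@beta_hausdorff R X). Qed.

Lemma sigma_remainder_base : has_compact_Gdelta_base S.
Proof.
exact: (sigma_rem_base (@beta_hausdorff R X) (@beta_compact R X)
  (@beta_in_dense R X) (open_range_beta_in R lcX) (@beta_extension R X) hullX).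
Qed.

End sigma_remainder_facts.

Theorem theorem3p19 (R : realType) (X Y : topologicalType)
    (lcX : locally_compact_space X) (pcX : paracompact_space X)
    (lcY : locally_compact_space Y) (pcY : paracompact_space Y) :
  order_isomorphic (TstarS_le X) (TstarS_le Y) <->
  homeomorphic (set_type (sigma_remainder R X)) (set_type (sigma_remainder R Y)).
Proof.
have isoX := TstarS_sigma_remainder_order R lcX pcX.
have isoY := TstarS_sigma_remainder_order R lcY pcY.
split=> [isoXY|/homeomorphic_compact_Gdelta_order isoS].
  apply: compact_Gdelta_order_homeomorphic; try exact: sigma_remainder_hausdorff.
  - exact: sigma_remainder_base.
  - exact: sigma_remainder_base.
  apply: order_isomorphic_trans isoY; apply: order_isomorphic_trans isoXY.
  exact: order_isomorphic_sym.
apply: order_isomorphic_trans (order_isomorphic_sym isoY).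
exact: order_isomorphic_trans isoS.
Qed.
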